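(* Assume problem $(\mathcal P)$ (defined in the context) is feasible, with optimal value $p^\star$, and let $g^\star$ be the optimal value of its Lagrange dual problem $(\mathcal D)$. Then $$p^\star-g^\star\le\sum_{i=1}^{\min(\tilde m,n)}\rho(f_i).$$
   Context: Setting. Let $N=\sum_{i=1}^n n_i$ and write $x=(x_1,\dots,x_n)\in\mathbf{R}^N$ with blocks $x_i\in\mathbf{R}^{n_i}$. For each $i$, $S_i\subset\mathbf{R}^{n_i}$ is a compact set and $f_i:S_i\to\mathbf{R}$ is lower semi-continuous (no convexity of $f_i$ or $S_i$ is assumed). Let $A\in\mathbf{R}^{m_1\times N}$, $b\in\mathbf{R}^{m_1}$, $G\in\mathbf{R}^{m_2\times N}$, $h\in\mathbf{R}^{m_2}$. The problem $(\mathcal P)$ is: minimize $f(x)=\sum_{i=1}^n f_i(x_i)$ subject to $Ax\le b$, $Gx=h$ (with $x_i\in S_i$ for all $i$); its optimal value is $p^\star$. A point $x$ is feasible for $(\mathcal P)$ if $Ax\le b$, $Gx=h$ and $x_i\in S_i$ for all $i$; $(\mathcal P)$ is feasible if it has a feasible point. It is assumed that each of the linear equality and inequality constraints involves at least two blocks of variables. Dual problem. The Lagrangian is $L(x,\lambda,\mu)=\sum_{i=1}^n f_i(x_i)+\lambda^T(Ax-b)+\mu^T(Gx-h)$, and $(\mathcal D)$ is: maximize $\inf_x L(x,\lambda,\mu)$ over $\lambda\in\mathbf{R}^{m_1}$, $\mu\in\mathbf{R}^{m_2}$ subject to $\lambda\ge 0$, where the infimum is over $x$ with $x_i\in S_i$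 for all $i$. Conventions. Functions are taken to be $+\infty$ outside their domains, and $\infty-\infty$ is interpreted as $0$. Inequalities are in the extended reals. Convex envelope and nonconvexity. $\hat f_i:\mathrm{conv}(S_i)\to\mathbf{R}$ denotes the convex envelope of $f_i$, the largest closed convex function majorized by $f_i$. The nonconvexity is $\rho(f_i)=\sup_x\,(f_i(x)-\hat f_i(x))\in[0,\infty]$, with $f_i$ and $\hat f_i$ equal to $+\infty$ outside their respective domains $S_i$ and $\mathrm{conv}(S_i)$ and with $\infty-\infty$ interpreted as $0$ (so it may be $+\infty$). The functions are indexed so that $\rho(f_1)\ge\cdots\ge\rho(f_n)$. Number of active constraints. For $x\in\mathbf{R}^N$ let $J(x)=\{j:(Ax-b)_j=0\}$ be the active set of inequality constraints, $\tilde m_1=\max_{x}|J(x)|$ the maximal number of inequality constraints that can be simultaneously active (maximum over $x\in\mathbf{R}^N$), and $\tilde m=\tilde m_1+m_2$. *)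

(* Defs.v *)
From HB Require Import structures.
From mathcomp Require Export all_boot all_order all_algebra.
From mathcomp Require Export all_classical all_reals all_analysis.
Export numFieldNormedType.Exports.

Set Implicit Arguments.
Unset Strict Implicit.
Unset Printing Implicit Defensive.

Import Order.TTheory GRing.Theory Num.Theory.
Local Open Scope classical_set_scope.
Local Open Scope ring_scope.

(* Subtraction in the extended reals with (+oo) - (+oo) = (-oo) - (-oo) = 0;
   the library's own [-] gives -oo there. *)
Definition esub {R : realType} (x y : \bar R) : \bar R :=
  if x == y then 0%E else (x - y)%E.

Section Envelope.
Context {R : realType} {k : nat}.
Implicit Types (S : set 'cV[R]_k) (f : 'cV[R]_k -> R) (g : 'cV[R]_k -> \bar R).

Definition convex_hull S : set 'cV[R]_k := smallest (@convex_set R 'cV[R]_k) S.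

Definition extend_infty S g : 'cV[R]_k -> \bar R := patch (cst +oo%E) S g.

Definition epigraph g : set ('cV[R]_k * R^o) := [set p | (g p.1 <= p.2%:E)%E].

(* A function on a subset of R^k is represented by its extension by +oo; it
   never takes the value -oo. *)
Definition closed_convex g : Prop :=
  [/\ forall x, (-oo < g x)%E, closed (epigraph g) & convex_set (epigraph g)].

Definition closed_convex_minorant g : set ('cV[R]_k -> \bar R) :=
  [set h | closed_convex h /\ forall x, (h x <= g x)%E].

(* The largest element of [closed_convex_minorant g] as soon as this set is
   nonempty, see [greatest_minorantP]. *)
Definition greatest_minorant g : 'cV[R]_k -> \bar R :=
  fun x => ereal_sup [set h x | h in closed_convex_minorant g].

(* [f] is only meaningful on [S]; the envelope lives on [convex_hull S]. *)
Definition convex_envelope S f : 'cV[R]_k -> \bar R :=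
  extend_infty (convex_hull S)
    (greatest_minorant (extend_infty S (EFin \o f))).

Definition nonconvexity S f : \bar R :=
  ereal_sup [set esub (extend_infty S (EFin \o f) x) (convex_envelope S f x)
            | x in [set: 'cV[R]_k]].

Lemma greatest_minorantP g : closed_convex_minorant g !=set0 ->
  closed_convex_minorant g (greatest_minorant g) /\
  forall h, closed_convex_minorant g h ->
    forall x, (h x <= greatest_minorant g x)%E.
Proof.
move=> [h0 h0g].
have ge h : closed_convex_minorant g h ->
    forall x, (h x <= greatest_minorant g x)%E.
  by move=> hg x; apply: ereal_sup_ubound; exists h.
have epiE : epigraph (greatest_minorant g) =
    \bigcap_(h in closed_convex_minorant g) epigraph h.
  apply/seteqP; split=> [p gp h hg|p hp]; first exact: le_trans (ge h hg _) gp.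
  by apply: ge_ereal_sup => _ [h hg <-]; exact: hp.
split=> //; split; last first.
  by move=> x; apply: ge_ereal_sup => _ [h [_ hg] <-]; exact: hg.
split=> [x||].
- by apply: lt_le_trans (ge h0 h0g x); case: h0g => -[].
- by rewrite epiE; apply: closed_bigI => h [[_ + _] _].
- rewrite epiE => x y t /set_mem hx /set_mem hy; apply/mem_set => h hg.
  have [[_ _ cvx] _] := hg.
  by apply/set_mem/cvx; apply/mem_set; [exact: hx|exact: hy].
Qed.

End Envelope.

Section Problem.
Context {R : realType} {n : nat} (d : 'I_n -> nat).
Local Notation N := (\sum_i d i)%N.
Context (S : forall i, set 'cV[R]_(d i)) (f : forall i, 'cV[R]_(d i) -> R).

Definition in_domain (x : 'cV[R]_N) : Prop := forall i, S (submxcol x i).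

Definition objective (x : 'cV[R]_N) : R := \sum_i f (submxcol x i).

Definition at_least_two_blocks {m} (M : 'M[R]_(m, N)) : Prop :=
  forall j : 'I_m, (1 < #|[set i : 'I_n | row j (submxrow M i) != 0%R]%SET|)%N.

Context {m1 m2 : nat} (A : 'M[R]_(m1, N)) (b : 'cV[R]_m1)
        (G : 'M[R]_(m2, N)) (h : 'cV[R]_m2).

Definition feasible (x : 'cV[R]_N) : Prop :=
  [/\ forall j, (A *m x) j 0 <= b j 0, G *m x = h & in_domain x].

Definition primal_value : \bar R :=
  ereal_inf [set (objective x)%:E | x in [set x | feasible x]].

Definition lagrangian (x : 'cV[R]_N) (lam : 'cV[R]_m1) (mu : 'cV[R]_m2) : R :=
  objective x + (lam^T *m (A *m x - b)) 0 0 + (mu^T *m (G *m x - h)) 0 0.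

Definition dual_function (lam : 'cV[R]_m1) (mu : 'cV[R]_m2) : \bar R :=
  ereal_inf [set (lagrangian x lam mu)%:E | x in [set x | in_domain x]].

Definition dual_value : \bar R :=
  ereal_sup [set dual_function p.1 p.2
            | p in [set p : 'cV[R]_m1 * 'cV[R]_m2 | forall j, 0 <= p.1 j 0]].

Definition active_set (x : 'cV[R]_N) : {set 'I_m1} :=
  [set j | (A *m x - b) j 0 == 0]%SET.

(* The maximum of #|active_set x| over all x, taken over the finitely many
   values of active_set. *)
Definition max_active : nat :=
  \max_(J : {set 'I_m1} | `[< exists x, active_set x = J >]) #|J|.

End Problem.

(* Main.v *)
(* Relax each block: replace a point of S_i by a finite mixture of points of S_i,
   and average both the cost and the constraints.  Mixtures with a bounded number
   of points form a compact space, so minimizing a quadratic penalty over them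
   yields either multipliers whose dual value exceeds g*, or a relaxed solution
   of cost at most g*; no constraint qualification is needed.  With its points
   fixed, a relaxed solution is a feasible point of a linear program in the
   weights.  A basic solution of this program has at most n + m2 + |J| nonzero
   weights, where J is the set of active inequalities at the averaged point, and
   each of the n blocks needs one weight; so at most m~ blocks carry a genuine
   mixture.  Only in these blocks does f_i exceed the averaged cost, by at most
   rho(f_i). *)
Require Import Defs.
From mathcomp Require Import ring lra.

Import Order.TTheory GRing.Theory Num.Theory.
Local Open Scope classical_set_scope.
Local Open Scope ring_scope.

(** * Basic solutions of linear programs in nonnegative weights *)

Section BasicSolution.
Context {R : realFieldType}.

(** The ratio test of the simplex method: [tau] is the least ratio [s k / - d k] over the decreasing
    entries. The entry attaining it reaches 0, and entries already 0 stay there. *)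
Lemma max_feasible_step {K : finType} (s d : K -> R) :
  (forall k, 0 <= s k) -> (forall k, s k = 0 -> d k = 0) ->
  (exists k, d k < 0) ->
  exists tau, [/\ 0 <= tau, forall k, 0 <= s k + tau * d k &
    (#|[set k | (s k + tau * d k)%R != 0%R]%SET| <
      #|[set k | s k != 0%R]%SET|)%N].
Proof.
move=> s0 sd [k1 dk1].
pose r k := s k / - d k.
have [k0 dk0 k0min] :=
  @Order.TotalTheory.arg_minP _ _ _ _ (fun k => d k < 0) r dk1.
exists (r k0); split.
- by apply: divr_ge0 => //; rewrite oppr_ge0 ltW.
- move=> k; have [dk|dk] := leP 0 (d k).
    by rewrite addr_ge0 // mulr_ge0 // divr_ge0 // oppr_ge0 ltW.
  have := k0min k dk; rewrite /r (ler_pdivlMr _ (s k)) ?oppr_gt0 //.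
  by rewrite mulrN -subr_ge0 opprK.
- apply: proper_card; apply/properP; split.
    apply/fintype.subsetP => k; rewrite !inE; apply: contraNN => /eqP sk.
    by rewrite sk (sd _ sk) mulr0 addr0.
  have dk0' : d k0 != 0 by rewrite lt_eqF.
  exists k0; rewrite !inE.
    by apply: contraNN dk0' => /eqP/sd ->.
  by rewrite negbK /r invrN mulrN mulNr divfK // subrr.
Qed.

(** A matrix with more rows than columns has a nonzero left kernel vector; it is extended by 0
    outside [D]. *)
Lemma kernel_supported {T P : finType} (D : {set T}) (e : T -> P -> R) :
  (#|P| < #|D|)%N ->
  exists delta : T -> R, [/\ forall t, t \notin D -> delta t = 0,
    exists t, delta t != 0 & forall p, \sum_t delta t * e t p = 0].
Proof.
move=> PD.
pose M : 'M[R]_(#|D|, #|P|) :=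
  \matrix_(i, j) e (enum_val i) (enum_val j).
have /rowV0Pn[v vM v0] : kermx M != 0.
  rewrite kermx_eq0 /row_free neq_ltn; apply/orP; left.
  by rewrite (leq_ltn_trans (rank_leq_col _)).
exists (fun t => \sum_(i | enum_val i == t) v 0 i); split.
- move=> t tD; rewrite big_pred0 // => i.
  by apply: contraNF tD => /eqP <-; exact: enum_valP.
- have [i vi] : exists i, v 0 i != 0.
    apply/existsP; apply: contraNT v0; rewrite negb_exists => /forallP v0.
    by apply/eqP/rowP => i; rewrite mxE; apply/eqP; have := v0 i; rewrite negbK.
  exists (enum_val i); rewrite (big_pred1 i) // => j.
  by rewrite (inj_eq enum_val_inj).
- move=> p; under eq_bigr => t _ do rewrite mulr_suml big_mkcond.
  rewrite exchange_big /=.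
  move/sub_kermxP/rowP/(_ (enum_rank p)) : vM; rewrite !mxE => vM.
  rewrite -[RHS]vM; apply: eq_bigr => i _; rewrite -big_mkcond /=.
  rewrite (big_pred1 (enum_val i)) => [|t]; last by rewrite eq_sym.
  by rewrite mxE enum_rankK.
Qed.

(* Moving along a kernel direction that does not increase the cost until a
   weight vanishes or a constraint becomes active decreases the number of
   nonzero slacks; the first hypothesis makes every such move bounded. *)
Lemma basic_solution {T P Q : finType} (e : T -> P -> R) (g : T -> Q -> R)
    (c : Q -> R) (w theta : T -> R) :
  (forall delta : T -> R, (forall p, \sum_t delta t * e t p = 0) ->
    \sum_t delta t = 0) ->
  (forall t, 0 <= theta t) -> (forall q, \sum_t theta t * g t q <= c q) ->
  exists theta', [/\ forall t, 0 <= theta' t,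
    forall p, \sum_t theta' t * e t p = \sum_t theta t * e t p,
    forall q, \sum_t theta' t * g t q <= c q,
    \sum_t theta' t * w t <= \sum_t theta t * w t &
    (#|[set t | theta' t != 0%R]%SET| <=
      #|P| + #|[set q | (\sum_t theta' t * g t q)%R == c q]%SET|)%N].
Proof.
move=> esum.
pose slack (theta : T -> R) (k : T + Q) := match k with
  | inl t => theta t | inr q => c q - \sum_t theta t * g t q end.
have [m] := ubnP #|[set k | slack theta k != 0%R]%SET|.
elim: m theta => // m IH theta; rewrite ltnS => lem th0 thc.
have [?|] := leqP #|[set t | theta t != 0%R]%SET|
    (#|P| + #|[set q | (\sum_t theta t * g t q)%R == c q]%SET|).
  by exists theta; split.
set D := [set t | theta t != 0%R]%SET.
pose act := [set q | \sum_t theta t * g t q == c q]%SET => Dbig.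
(* Active inequalities are added as equations, so that the move keeps them active. *)
pose e' t (p : P + {q | q \in act}) :=
  match p with inl p => e t p | inr q => g t (val q) end.
have [|delta [dD d0 dk]] := @kernel_supported T _ D e'.
  by rewrite card_sum card_sig.
wlog dw : delta dD d0 dk / \sum_t delta t * w t <= 0.
  move=> hwlog; have [/hwlog|dw] := leP (\sum_t delta t * w t) 0; first exact.
  apply: (hwlog (fun t => - delta t)).
  - by move=> t /dD ->; rewrite oppr0.
  - by have [t] := d0; exists t; rewrite oppr_eq0.
  - by move=> p; under eq_bigr do rewrite mulNr; rewrite sumrN dk oppr0.
  - under eq_bigr do rewrite mulNr.
    by rewrite sumrN oppr_le0 ltW.
have de p : \sum_t delta t * e t p = 0 by rewrite -[RHS](dk (inl p)).
have dsum : \sum_t delta t = 0 by exact: esum.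
(* A nonzero direction with zero sum has a negative entry, hence the move is bounded. *)
have [t1 dt1] : exists t, delta t < 0.
  apply: contrapT => dge0; have [t /eqP] := d0; apply.
  have {}dge0 s : 0 <= delta s.
    by rewrite leNgt; apply/negP => ?; apply: dge0; exists s.
  apply/eqP; move/eqP: dsum; rewrite psumr_eq0 // => /allP/(_ t).
  by rewrite mem_index_enum => /(_ isT).
pose dir (k : T + Q) := match k with
  | inl t => delta t | inr q => - \sum_t delta t * g t q end.
have lin tau (u : T -> R) : \sum_t (theta t + tau * delta t) * u t =
    \sum_t theta t * u t + tau * \sum_t delta t * u t.
  rewrite mulr_sumr -big_split; apply: eq_bigr => t _ /=.
  by rewrite mulrDl mulrA.
have [|||tau [tau0 taus taulem]] := @max_feasible_step _ (slack theta) dir.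
- by move=> [t|q] //=; rewrite subr_ge0.
- move=> [t|q] /=; first by move=> /eqP th; apply: dD; rewrite inE negbK.
  move/eqP; rewrite subr_eq0 eq_sym => qa.
  have qact : q \in act by rewrite inE.
  by have := dk (inr (exist _ q qact)) => /= ->; rewrite oppr0.
- by exists (inl t1).
pose theta1 t := theta t + tau * delta t.
have slackE k : slack theta1 k = slack theta k + tau * dir k.
  by case: k => [t|q] //=; rewrite lin mulrN opprD addrA.
have [||| theta2 [? eq2 ? w2 ?]] := IH theta1.
- move: taulem; under eq_finset do rewrite -slackE.
  by move=> /leq_trans; exact.
- by move=> t; exact: (taus (inl t)).
- by move=> q; rewrite -subr_ge0 lin opprD addrA -mulrN; exact: (taus (inr q)).
exists theta2; split=> //.
- by move=> p; rewrite eq2 lin de mulr0 addr0.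
- by rewrite (le_trans w2) // lin gerDl mulr_ge0_le0.
Qed.

End BasicSolution.

(** * Lower limits along filters and attainment of minima *)

Section LowerLimit.
Context {R : realType}.

(** With [F] equal to [within K (nbhs x)] and [a] equal to [q x], this is lower semicontinuity at
    [x] relative to [K]. *)
Definition liminf_ge {X : Type} (F : set_system X) (q : X -> R) (a : R) :=
  forall b, b < a -> \forall x \near F, b < q x.

(** Without a minimizer, every point of [K] has a neighbourhood in [K] on which [q] exceeds some
    value [q y]. Compactness makes this uniform along the filter of sublevel sets, which produces an
    [i] with [q i < q i]. *)
Lemma lsc_attains_min {X : topologicalType} (K : set X) (q : X -> R) :
  compact K -> K !=set0 ->
  (forall x, K x -> liminf_ge (within K (nbhs x)) q (q x)) ->
  exists2 x, K x & forall y, K y -> q x <= q y.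
Proof.
move=> /compact_near_coveringP Kc [x0 Kx0] qlsc.
apply: contrapT => nomin.
have lower x : K x -> exists2 y, K y & q y < q x.
  move=> Kx; apply: contrapT => nlt; apply: nomin; exists x => // y Ky.
  by rewrite leNgt; apply/negP => ?; apply: nlt; exists y.
pose B y0 := [set y | K y /\ q y <= q y0].
have FF : ProperFilter (filter_from K B).
  apply: filter_from_proper; last by move=> y Ky; exists y; split.
  apply: filter_from_filter; first by exists x0.
  move=> y z Ky Kz; have [yz|/ltW zy] := leP (q y) (q z).
    by exists y => // t [Kt ty]; split; split=> //; exact: le_trans yz.
  by exists z => // t [Kt tz]; split; split=> //; exact: le_trans zy.
have /= near_lt := Kc X (filter_from K B) (fun i x => K x -> q i < q x) _.
have : \forall i \near filter_from K B, K `<=` (fun x => K x -> q i < q x).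
  apply: near_lt => x Kx.
  have [y Ky yx] := lower x Kx.
  have /(_ _ yx) := qlsc x Kx; rewrite nearE /within /= => near_x.
  exists ([set x' | K x' -> q y < q x'], B y).
    by split=> //=; exists y.
  move=> [x' i] /= [near_x' [Ki iy]] Kx'.
  exact: le_lt_trans iy (near_x' Kx').
have KF : \forall i \near filter_from K B, K i by exists x0 => // i [].
move=> /(filterI KF)/filter_ex[i [Ki /(_ i Ki Ki)]].
by rewrite ltxx.
Qed.

Context {X : Type} (F : set_system X) {FF : ProperFilter F}.
Implicit Types (q : X -> R).

Lemma liminf_ge_cvg q a : q x @[x --> F] --> a -> liminf_ge F q a.
Proof. by move=> qa b ba; apply: (cvgr_gt a). Qed.

Lemma liminf_ge_add q r a c : liminf_ge F q a -> liminf_ge F r c ->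
  liminf_ge F (fun x => q x + r x) (a + c).
Proof.
move=> qa rc b bac; pose e := (a + c - b) / 2.
have e0 : 0 < e by rewrite /e; lra.
have /qa qe : a - e < a by lra.
have /rc re : c - e < c by lra.
near=> x.
have : a - e < q x by near: x.
have : c - e < r x by near: x.
rewrite /e; lra.
Unshelve. all: by end_near. Qed.

Lemma liminf_ge_sum {I : finType} (q : I -> X -> R) (a : I -> R) :
  (forall i, liminf_ge F (q i) (a i)) ->
  liminf_ge F (fun x => \sum_i q i x) (\sum_i a i).
Proof.
move=> qa; elim: (index_enum I) => [|i s IH].
  under eq_fun do rewrite big_nil.
  by rewrite big_nil; apply: liminf_ge_cvg; exact: cvg_cst.
under eq_fun do rewrite big_cons.
by rewrite big_cons; exact: liminf_ge_add.
Qed.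

(** Since [theta] is eventually nonnegative, the product is eventually at least [theta x * (a - e)],
    which converges. *)
Lemma liminf_ge_mul (theta q : X -> R) (t a : R) :
  (\forall x \near F, 0 <= theta x) -> theta x @[x --> F] --> t ->
  liminf_ge F q a -> liminf_ge F (fun x => theta x * q x) (t * a).
Proof.
move=> th0 tht qa b bta.
have t0 : 0 <= t by apply: (cvgr_to_ge tht).
(* Chosen so that [t * e] stays below [t * a - b]; the [+ 1] covers [t = 0]. *)
pose e := (t * a - b) / (2 * (t + 1)).
have e0 : 0 < e by rewrite divr_gt0 ?subr_gt0 // mulr_gt0 //; lra.
have te : b < t * (a - e).
  have : e * (2 * (t + 1)) = t * a - b by rewrite divfK //; lra.
  nra.
have /qa qe : a - e < a by lra.
have cv : theta x * (a - e) @[x --> F] --> t * (a - e) by apply: cvgMr_tmp.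
have near_b : \forall x \near F, b < theta x * (a - e) by exact: cvgr_gt cv _ te.
near=> x; apply: (@lt_le_trans _ _ (theta x * (a - e))); first by near: x.
by apply: ler_wpM2l; [near: x|apply/ltW; near: x].
Unshelve. all: by end_near. Qed.

(** Continuity gives a point [z < a] with [b < phi z], and monotonicity carries the bound to every
    [q x] above [z]. *)
Lemma liminf_ge_comp (phi : R -> R) q a :
  {homo phi : x y / x <= y} -> {for a, continuous phi} ->
  liminf_ge F q a -> liminf_ge F (phi \o q) (phi a).
Proof.
move=> phi_homo phic qa b bphi.
have : \forall z \near a^'-, b < phi z.
  by apply: (cvgr_gt (phi a)) => //; exact: cvg_at_left_filter.
have alt : \forall z \near a^'-, z < a by exact: nbhs_left_lt.
move=> /(filterI alt)/filter_ex[z [/qa za bz]].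
near=> x; apply: lt_le_trans bz _; apply: phi_homo; apply/ltW.
by near: x.
Unshelve. all: by end_near. Qed.

End LowerLimit.

(** * A theorem of the alternative for mixtures *)

Section Alternative.
Context {R : realType}.

Lemma cvg_sum {X I : Type} (F : set_system X) {FF : Filter F} (s : seq I)
    (u : I -> X -> R) (l : I -> R) :
  (forall i, u i x @[x --> F] --> l i) ->
  \sum_(i <- s) u i x @[x --> F] --> \sum_(i <- s) l i.
Proof.
move=> ul; elim: s => [|i s IH].
  by under eq_fun do rewrite big_nil; rewrite big_nil; exact: cvg_cst.
by under eq_fun do rewrite big_cons; rewrite big_cons; exact: cvgD.
Qed.

(** Presents the total weight of a block as one of the linear forms taken by [basic_solution]. *)
Lemma sum_pair_fst {I J : finType} (F : I * J -> R) (i : I) :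
  \sum_t F t * (t.1 == i)%:R = \sum_j F (i, j).
Proof.
rewrite (reindex (fun ij : I * J => (ij.1, ij.2))) /=; last first.
  by exists id => -[].
rewrite -(pair_bigA _ (fun i' j => F (i', j) * (i' == i)%:R)) /= (bigD1 i) //=.
rewrite [X in _ + X]big1 ?addr0 => [|i' /negPf ->].
  by apply: eq_bigr => j _; rewrite eqxx mulr1.
by rewrite big1 // => j _; rewrite mulr0.
Qed.

Lemma sum_pair_snd_eq {I J : finType} (F : I * J -> R) (s : I -> J) :
  \sum_t (t.2 == s t.1)%:R * F t = \sum_i F (i, s i).
Proof.
transitivity (\sum_i \sum_j (j == s i)%:R * F (i, j)).
  by rewrite pair_bigA /=; apply: eq_bigr => -[].
apply: eq_bigr => i _; rewrite (bigD1 (s i)) //= eqxx mul1r.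
by rewrite big1 ?addr0 // => j /negPf ->; rewrite mul0r.
Qed.

(** First-order optimality of [u] on the segment towards [v]: the derivative at 0 of the squared
    norm is nonnegative. *)
Lemma sum_sqr_first_order {I : finType} (u v : I -> R) :
  (forall e, 0 < e < 1 ->
    \sum_i u i ^+ 2 <= \sum_i ((1 - e) * u i + e * v i) ^+ 2) ->
  \sum_i u i ^+ 2 <= \sum_i u i * v i.
Proof.
move=> umin; rewrite leNgt; apply/negP => gap.
set q := \sum_i u i ^+ 2 in umin gap; set p := \sum_i u i * v i in gap.
pose w := \sum_i (u i - v i) ^+ 2.
have w0 : 0 <= w by apply: sumr_ge0 => i _; exact: sqr_ge0.
have qE e : \sum_i ((1 - e) * u i + e * v i) ^+ 2 =
    q - 2 * e * (q - p) + e ^+ 2 * w.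
  rewrite /q /p /w -sumrB !mulr_sumr -sumrB -big_split /=.
  by apply: eq_bigr => i _; ring.
(* This step lies in []0, 1[] and satisfies [e * w < q - p], so the linear decrease beats the
   quadratic term. *)
pose e := (q - p) / (w + (q - p) + 1).
have den0 : 0 < w + (q - p) + 1 by lra.
have eden : e * (w + (q - p) + 1) = q - p by rewrite divfK ?gt_eqF.
have e0 : 0 < e by rewrite divr_gt0 // subr_gt0.
have e1 : e < 1 by rewrite ltr_pdivrMr //; lra.
have := umin e; rewrite e0 e1 => /(_ isT); rewrite qE.
have : e * (e * w) < e * (q - p) by rewrite ltr_pM2l //; nra.
nra.
Qed.

(* A mixture puts finitely many weighted points in each block.  The minimum of
   the penalty [\sum_k (max 0 (residual k))^2] over mixtures with a large fixed
   number of slots is attained; if it is positive, the positive parts of the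
   residuals at a minimizer are the multipliers.  Thinning the support of the
   minimizer leaves a free slot in each block, so that it can be perturbed
   towards any point. *)
Theorem mixture_alternative {n : nat} (X : 'I_n -> topologicalType)
    (S : forall i, set (X i)) {I : finType} (phi : forall i, X i -> I -> R)
    (beta : I -> R) :
  (forall i, compact (S i)) -> (forall i, S i !=set0) ->
  (forall i k x, S i x ->
    liminf_ge (within (S i) (nbhs x)) (fun x => phi i x k) (phi i x k)) ->
  (exists (lam : I -> R) (eta : R), [/\ forall k, 0 <= lam k, 0 < eta &
    forall x : forall i, X i, (forall i, S i (x i)) ->
      eta <= \sum_k lam k * (\sum_i phi i (x i) k - beta k)]) \/
  (exists L (theta : 'I_n * 'I_L -> R) (y : forall t : 'I_n * 'I_L, X t.1),
    [/\ forall t, 0 <= theta t, forall i, \sum_k theta (i, k) = 1,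
      forall t, S t.1 (y t) &
      forall k, \sum_t theta t * phi t.1 (y t) k <= beta k]).
Proof.
move=> Sc Sn0 phi_lsc.
(* One slot more than the size of a basic support, so that no block can be full. *)
pose L := (n + #|I|).+1.
pose T := ('I_n * 'I_L)%type.
pose C : topologicalType := prod_topology (fun t : T => (X t.1 * R)%type).
pose res (c : C) k := \sum_t (c t).2 * phi t.1 (c t).1 k - beta k.
pose q c := \sum_k Num.max (res c k) 0 ^+ 2.
pose K : set C := [set c | forall t, (S t.1 `*` `[0, 1]%classic) (c t)] `&`
  [set c | forall i, \sum_k (c (i, k)).2 = 1].
have weightK (theta : T -> R) (y : forall t : T, X t.1) :
    (forall t, 0 <= theta t) -> (forall i, \sum_k theta (i, k) = 1) ->
    (forall t, S t.1 (y t)) -> K (fun t => (y t, theta t)).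
  move=> th0 th1 yS; split=> //= -[i k]; split=> //=.
    exact: (yS (i, k)).
  rewrite in_itv /= th0 /=.
  by rewrite -(th1 i) (bigD1 k) //= lerDl sumr_ge0.
have snd_cvg (t : T) (c : C) : (z t).2 @[z --> c] --> (c t).2.
  apply: (@continuous_comp _ _ _ (fun z : C => z t) snd).
    exact: (@proj_continuous T (fun t : T => (X t.1 * R)%type) t).
  exact: cvg_snd.
have fst_cvg (t : T) (c : C) : (z t).1 @[z --> c] --> (c t).1.
  apply: (@continuous_comp _ _ _ (fun z : C => z t) fst).
    exact: (@proj_continuous T (fun t : T => (X t.1 * R)%type) t).
  exact: cvg_fst.
have Kc : compact K.
  apply: compact_closedI.
    apply: (@tychonoff T (fun t : T => (X t.1 * R)%type)
      (fun t => S t.1 `*` `[0, 1]%classic)) => t.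
    by apply: compact_setX => //; exact: segment_compact.
  rewrite (_ : [set c | _] = \bigcap_i [set c : C | \sum_k (c (i, k)).2 = 1]).
    apply: closed_bigI => i _.
    apply: (@closed_comp _ _ (fun c : C => \sum_k (c (i, k)).2) [set 1]).
      move=> c _; apply: (@cvg_sum _ _ (nbhs c) (nbhs_filter c)) => k.
      exact: snd_cvg.
    exact: closed_eq.
  by apply/seteqP; split=> [c cs i _|c cs i]; exact: cs.
have Kn0 : K !=set0.
  have [p pS] : exists p : forall i, X i, forall i, S i (p i).
    by exists (fun i => sval (cid (Sn0 i))) => i; exact: svalP (cid (Sn0 i)).
  exists (fun t => (p t.1, (t.2 == ord0)%:R)).
  apply: weightK => // i.
  by rewrite (bigD1 ord0) //= big1 ?addr0 // => k /negPf ->.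
have q_lsc c : K c -> liminf_ge (within K (nbhs c)) q (q c).
  move=> Kc'.
  have FF : ProperFilter (within K (nbhs c)).
    by apply: within_nbhs_proper; exact: subset_closure.
  apply: liminf_ge_sum => k.
  (* The squared positive part is monotone and continuous, so lower limits of residuals pass to the
     penalty. *)
  apply: (@liminf_ge_comp _ _ _ _ (fun z => Num.max z 0 ^+ 2)).
  - move=> z z' zz'.
    have pos0 (u : R) : Num.max u 0 \in Num.nneg.
      by rewrite nnegrE le_max lexx orbT.
    by rewrite ler_sqr // ge_max !le_max zz' lexx orbT.
  - apply: (@continuous_comp _ _ _ (fun z : R => Num.max z 0) (fun z => z ^+ 2)).
      by apply: continuous_max; [exact: cvg_id|exact: cvg_cst].
    exact: exprn_continuous.
  apply: liminf_ge_add; last by apply: liminf_ge_cvg; exact: cvg_cst.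
  apply: liminf_ge_sum => t; apply: liminf_ge_mul.
  - rewrite nearE /within /=; apply: filterE => z [/(_ t)[_ /=]].
    by rewrite in_itv /= => /andP[].
  - by apply: cvg_within_filter; exact: snd_cvg.
  - move=> e ephi; have cS : S t.1 (c t).1 by case: Kc' => /(_ t)[].
    have := phi_lsc t.1 k _ cS _ ephi; rewrite !nearE /within /= => near_phi.
    have near_c := fst_cvg t c _ near_phi.
    apply: (@filterS _ (nbhs c) (nbhs_filter c) _ _ _ near_c) => z zphi Kz.
    by apply: zphi; case: Kz => /(_ t)[].
have [c0 Kc0 c0min] := lsc_attains_min _ _ Kc Kn0 q_lsc.
pose y t := (c0 t).1; pose theta0 t := (c0 t).2.
have theta0_ge0 t : 0 <= theta0 t.
  by have [/(_ t)[_ /= th01] _] := Kc0; move: th01; rewrite in_itv /= => /andP[].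
have theta0_sum i : \sum_k theta0 (i, k) = 1 by case: Kc0 => _; exact.
have yS t : S t.1 (y t) by have [/(_ t)[]] := Kc0.
have [res_le0|/existsNP[k0 /negP]] := pselect (forall k, res c0 k <= 0).
  right; exists L, theta0, y; split=> // k.
  by rewrite -subr_le0; exact: res_le0.
rewrite -ltNge => resk0; left.
pose lam k := Num.max (res c0 k) 0.
have lam0 k : 0 <= lam k by rewrite le_max lexx orbT.
exists lam, (q c0); split=> // [|x xS].
  rewrite /q (bigD1 k0) //= ltr_pwDl ?sumr_ge0 // => [|k _]; last exact: sqr_ge0.
  by rewrite exprn_gt0 // lt_max resk0.
(* The [n + #|I|] equations preserve the block weights and all residuals. There are no inequalities,
   so this number alone bounds the support. *)
pose e (t : T) (p : 'I_n + I) := match p with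
  | inl i => (t.1 == i)%:R | inr k => phi t.1 (y t) k end.
have [||theta [th0 th_eq _ _ supp]] := @basic_solution _ T ('I_n + I)%type void
    e (fun=> fun=> 0) (fun=> 0) (fun=> 0) theta0 _ theta0_ge0.
- move=> delta de; transitivity (\sum_i \sum_k delta (i, k)).
    by rewrite pair_bigA /=; apply: eq_bigr => -[].
  by apply: big1 => i _; rewrite -sum_pair_fst; exact: (de (inl i)).
- by case.
have th_sum i : \sum_k theta (i, k) = 1.
  by have := th_eq (inl i); rewrite /e !sum_pair_fst theta0_sum.
have res_th k : \sum_t theta t * phi t.1 (y t) k - beta k = res c0 k.
  by have := th_eq (inr k); rewrite /e /= => ->.
have /choice[s sfree] : forall i, exists k : 'I_L, theta (i, k) = 0.
  move=> i.
  apply: contrapT => /forallNP full.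
  have /leq_trans/(_ supp) : (L <= #|[set t | theta t != 0%R]%SET|)%N.
    have pair_i_inj : injective (@pair 'I_n 'I_L i) by move=> k k' [].
    rewrite -[X in (X <= _)%N]card_ord -(card_imset _ pair_i_inj).
    apply/subset_leq_card/fintype.subsetP => _ /imsetP[k _ ->].
    by rewrite inE; apply/eqP; exact: full.
  rewrite card_sum card_ord (_ : [set _ | _]%SET = finset.set0) ?cards0.
    by rewrite addn0 /L ltnn.
  by apply/setP => -[].
apply: sum_sqr_first_order => eps /andP[eps0 eps1].
(* The point [x i] goes into the free slot of block [i] with weight [eps]; since that slot had
   weight 0, residuals change affinely in [eps]. *)
pose theta2 (t : T) := (1 - eps) * theta t + eps * (t.2 == s t.1)%:R.
pose y2 (t : T) := if t.2 == s t.1 then x t.1 else y t.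
have K2 : K (fun t => (y2 t, theta2 t)).
  apply: weightK => [t|i|t].
  - by rewrite addr_ge0 ?mulr_ge0 ?ler0n ?th0 ?(ltW eps0) // subr_ge0 ltW.
  - rewrite /theta2 big_split /= -!mulr_sumr th_sum.
    rewrite (bigD1 (s i)) //= eqxx big1 => [|k /negPf ->] //.
    by rewrite addr0 !mulr1 subrK.
  - by rewrite /y2; case: ifP.
apply: le_trans (c0min _ K2) _; apply: ler_sum => k _.
have -> : res (fun t => (y2 t, theta2 t)) k =
    (1 - eps) * res c0 k + eps * (\sum_i phi i (x i) k - beta k).
  rewrite -res_th /res /=.
  have <- := sum_pair_snd_eq (fun t : T => phi t.1 (x t.1) k) s.
  transitivity (\sum_t ((1 - eps) * (theta t * phi t.1 (y t) k) +
      eps * ((t.2 == s t.1)%:R * phi t.1 (x t.1) k)) - beta k).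
    congr (_ - _); apply: eq_bigr => t _; rewrite /theta2 /y2.
    case: eqP => [|_]; last by rewrite mulr0 mul0r mulr0 !addr0 mulrA.
    by case: t => i k' /= ->; rewrite sfree; ring.
  by rewrite big_split /= -!mulr_sumr; ring.
(* Replacing [r] by its positive part can only raise the perturbed residual, while [v] stays
   unclipped and thus enters the final inequality linearly. *)
set r := res c0 k; set v := \sum_i phi i (x i) k - beta k.
have : (1 - eps) * r + eps * v <= (1 - eps) * Num.max r 0 + eps * v.
  by rewrite lerD2r ler_wpM2l ?le_max ?lexx // subr_ge0 ltW.
set z := _ + eps * v; set z' := _ + eps * v => zz'.
have [z0|z0] := leP z 0; first by rewrite expr0n sqr_ge0.
by rewrite ler_sqr ?nnegrE ?(ltW z0) // (le_trans _ zz') // ltW.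
Qed.

End Alternative.

(** * Convex combinations, the convex envelope and the nonconvexity *)

Section ConvexEnvelope.
Context {R : realType}.

(** Convexity is stated for two points, so the induction runs over normalized partial means, defined
    once the partial weight is positive. *)
Lemma convex_set_sum {E : lmodType R} (C : set E) {J : finType}
    (theta : J -> R) (y : J -> E) :
  @convex_set R E C -> (forall j, 0 <= theta j) -> \sum_j theta j = 1 ->
  (forall j, C (y j)) -> C (\sum_j theta j *: y j).
Proof.
move=> Cc th0 th1 yC.
have mean (s : seq J) : 0 < \sum_(j <- s) theta j ->
    C ((\sum_(j <- s) theta j)^-1 *: \sum_(j <- s) theta j *: y j).
  elim: s => [|j s IH]; first by rewrite big_nil ltxx.
  rewrite !big_cons; set a := \sum_(j <- s) theta j in IH *.
  have a0 : 0 <= a by exact: sumr_ge0.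
  have [a_eq0|an0] := eqVneq a 0.
    rewrite big_seq big1 => [|k ks]; last first.
      suff -> : theta k = 0 by rewrite scale0r.
      move/eqP: a_eq0; rewrite psumr_eq0 // => /allP/(_ k ks)/= /eqP.
      exact.
    rewrite a_eq0 !addr0 => thj.
    by rewrite scalerA mulVf ?gt_eqF // scale1r.
  move=> sum_gt0; have a_gt0 : 0 < a by rewrite lt_neqAle eq_sym an0.
  have p0 : 0 <= theta j / (theta j + a) by rewrite divr_ge0 // ltW.
  have p1 : theta j / (theta j + a) <= 1 by rewrite ler_pdivrMr // mul1r lerDl.
  have := Cc (y j) _ (Itv01 p0 p1) (mem_set (yC j)) (mem_set (IH a_gt0)).
  move=> /set_mem; congr (C _).
  set v := \sum_(j <- s) _.
  transitivity (theta j / (theta j + a) *: y j +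
    (1 - theta j / (theta j + a)) *: (a^-1 *: v)) => //.
  rewrite scalerDr !scalerA; congr (_ *: _ + _ *: _).
    by rewrite mulrC.
  by field; rewrite ?gt_eqF.
have := mean (index_enum J); rewrite th1 ltr01 => /(_ isT).
by rewrite invr1 scale1r.
Qed.

Context {k : nat} (S : set 'cV[R]_k) (f : 'cV[R]_k -> R).

(** Jensen's inequality: the epigraph of each closed convex minorant contains the points
    [(y j, f (y j))], hence their mean. *)
Lemma convex_envelope_sum {J : finType} (theta : J -> R) (y : J -> 'cV[R]_k) :
  (forall j, 0 <= theta j) -> \sum_j theta j = 1 -> (forall j, S (y j)) ->
  (convex_envelope S f (\sum_j theta j *: y j)
   <= (\sum_j theta j * f (y j))%:E)%E.
Proof.
move=> th0 th1 yS; rewrite /convex_envelope /extend_infty patchT; last first.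
  by apply: mem_set => C [Cc SC]; apply: convex_set_sum => // j; exact: SC.
apply: ge_ereal_sup => _ [h [[_ _ hc] hle] <-].
have := @convex_set_sum ('cV[R]_k * R^o)%type (epigraph h) J theta
  (fun j => (y j, f (y j))) hc th0 th1.
have -> : \sum_j theta j *: ((y j, f (y j)) : 'cV[R]_k * R^o) =
    (\sum_j theta j *: y j, \sum_j theta j * f (y j)).
  apply: injective_projections => /=.
    by rewrite (big_morph fst (id1 := 0) (op1 := +%R)).
  by rewrite (big_morph snd (id1 := 0) (op1 := +%R)).
apply=> j; rewrite /epigraph /=; apply: le_trans (hle _) _.
by rewrite /extend_infty patchT //; exact: mem_set.
Qed.

Hypothesis S0 : S !=set0.

Lemma convex_envelope_le x : S x -> (convex_envelope S f x <= (f x)%:E)%E.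
Proof.
move=> Sx; have := @convex_envelope_sum unit (fun=> 1) (fun=> x).
by rewrite !big_const card_unit /= !addr0 scale1r mul1r; apply.
Qed.

Lemma nonconvexity_ge0 : (0 <= nonconvexity S f)%E.
Proof.
have [x Sx] := S0; apply: ereal_sup_ge.
exists (esub (extend_infty S (EFin \o f) x) (convex_envelope S f x)).
  by exists x.
rewrite /esub; case: ifP => // _.
rewrite {1}/extend_infty patchT ?mem_set //= sube_ge0 ?orbT //.
exact: convex_envelope_le.
Qed.

Hypothesis f_lb : exists a, forall x, S x -> a <= f x.

Lemma convex_envelope_gtNy x : (-oo < convex_envelope S f x)%E.
Proof.
rewrite /convex_envelope /extend_infty /patch; case: ifP => // _.
have [a fa] := f_lb; apply: (@lt_le_trans _ _ a%:E); first exact: ltNyr.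
(* The constant lower bound of [f] is itself a closed convex minorant. *)
apply: ereal_sup_ubound; exists (cst a%:E) => //; split; first split.
- by move=> ?; rewrite ltNyr.
- rewrite /epigraph (_ : [set p | _] = snd @^-1` [set r | a <= r]).
    apply: closed_comp; last exact: closed_ge.
    by move=> p _; exact: cvg_snd.
  by apply/seteqP; split=> p /=; rewrite lee_fin.
- move=> p p' l /set_mem + /set_mem; rewrite /epigraph /= !lee_fin => ap ap'.
  apply/mem_set; rewrite /= lee_fin.
  have -> : a = l%:num * a + (1 - l%:num) * a by ring.
  by apply: lerD; rewrite ler_wpM2l // subr_ge0.
- by move=> y; rewrite /patch; case: ifP => [/set_mem/fa|_]; rewrite ?leey ?lee_fin.
Qed.

(** The envelope is finite at [x], so [esub] is there an ordinary difference, or 0 when both values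
    agree; the latter case uses that the nonconvexity is nonnegative. *)
Lemma extend_infty_le_nonconvexity x v : (convex_envelope S f x <= v%:E)%E ->
  (extend_infty S (EFin \o f) x <= v%:E + nonconvexity S f)%E.
Proof.
move=> env_v.
have : (esub (extend_infty S (EFin \o f) x) (convex_envelope S f x)
    <= nonconvexity S f)%E by apply: ereal_sup_ubound; exists x.
move: env_v (convex_envelope_gtNy x) nonconvexity_ge0.
case: (convex_envelope S f x) => [e| |] //; rewrite lee_fin => ev _ rho0.
rewrite /esub; case: eqP => [->|_] rho.
  by rewrite -[leLHS]adde0 leeD.
rewrite leeBlDr // in rho.
by apply: le_trans rho _; rewrite [leLHS]addeC; apply: leeD2r; rewrite lee_fin.
Qed.

End ConvexEnvelope.

(** * Partial sums of a nonincreasing family *)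

Section SortedSum.
Context {R : realType}.
Local Open Scope ereal_scope.

Lemma sum_const_le {I : finType} (X Y : {set I}) (c : \bar R) :
  0 <= c -> (#|X| <= #|Y|)%N -> \sum_(i in X) c <= \sum_(i in Y) c.
Proof.
move=> c0 XY; rewrite !big_const -(subnK XY); elim: (_ - _)%N => [|k IH] //=.
by rewrite (le_trans IH) // leeDr.
Qed.

Lemma sum_sorted_le {n : nat} (rho : 'I_n -> \bar R) (B : {set 'I_n}) (m : nat) :
  (forall i, 0 <= rho i) ->
  (forall i j : 'I_n, (i <= j)%N -> rho j <= rho i) ->
  (#|B| <= m)%N -> \sum_(i in B) rho i <= \sum_(i < n | (i < m)%N) rho i.
Proof.
move=> rho0 rho_sorted Bm.
have [nm|mn] := leqP n m.
  apply: lee_sum_nneg_subset => [i _|i _]; last exact: rho0.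
  by rewrite unfold_in (leq_trans (ltn_ord i)).
pose M : {set 'I_n} := [set i : 'I_n | (i < m)%N]%SET.
have cardM : #|M| = m.
  rewrite -sum1_card (eq_bigl (fun i : 'I_n => (i < m)%N)) => [|i]; last first.
    by rewrite inE.
  by rewrite -(big_ord_widen n (fun=> 1%N) (ltnW mn)) sum1_card card_ord.
rewrite [leRHS](eq_bigl (fun i => i \in M)) => [|i]; last by rewrite inE.
rewrite (big_setID M) /= [leRHS](big_setID B) /= finset.setIC; apply: leeD2l.
(* After cancelling [B :&: M], the value at index [m], the first one outside [M], separates the
   terms left in [B] from those left in [M]. *)
pose c := rho (Ordinal mn).
apply: (@le_trans _ _ (\sum_(i in B :\: M) c)).
  by apply: lee_sum => i; rewrite !inE -leqNgt => /andP[? _]; exact: rho_sorted.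
apply: (@le_trans _ _ (\sum_(i in M :\: B) c)).
  apply: sum_const_le; first exact: rho0.
  rewrite -(leq_add2l #|B :&: M|) cardsID finset.setIC cardsID cardM.
  exact: Bm.
apply: lee_sum => i; rewrite !inE => /andP[_ im].
by apply: rho_sorted; exact: ltnW.
Qed.

End SortedSum.

(** * The relaxed problem and its comparison with the dual *)

Section Relaxation.
Context {R : realType} {n : nat} (d : 'I_n -> nat).
Context (S : forall i, set 'cV[R]_(d i)) (f : forall i, 'cV[R]_(d i) -> R).
Arguments f {i}.

Lemma mulmx_blocks {m} (M : 'M[R]_(m, \sum_i d i)) (x : 'cV[R]_(\sum_i d i)) j :
  (M *m x) j 0 = \sum_i (submxrow M i *m submxcol x i) j 0.
Proof.
by rewrite -[in LHS](submxrowK M) -[in LHS](submxcolK x) mul_mxrow_mxcol summxE.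
Qed.

Context {m1 m2 : nat} (A : 'M[R]_(m1, \sum_i d i)) (b : 'cV[R]_m1)
        (G : 'M[R]_(m2, \sum_i d i)) (h : 'cV[R]_m2).

Lemma lagrangianE x lam mu : lagrangian (@f) A b G h x lam mu =
  objective (@f) x + \sum_j lam j 0 * ((A *m x) j 0 - b j 0) +
  \sum_j mu j 0 * ((G *m x) j 0 - h j 0).
Proof.
by rewrite /lagrangian !mxE; congr (_ + _ + _);
  apply: eq_bigr => j _; rewrite !mxE.
Qed.

Hypothesis S_compact : forall i, compact (S i).
Hypothesis f_lsc : forall i, lower_semicontinuous
       (fun x : subspace (S i) => (f x)%:E).

Lemma block_liminf_ge i x : S i x ->
  liminf_ge (within (S i) (nbhs x)) f (f x).
Proof.
move=> Sx a; rewrite -lte_fin => /(f_lsc i x a)[V].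
rewrite /nbhs /= -(nbhs_subspace_in Sx) => xV Va.
by apply: filterS xV => y /Va; rewrite lte_fin.
Qed.

Lemma block_lower_bound i : S i !=set0 -> exists a, forall x, S i x -> a <= f x.
Proof.
move=> Sn0; have [x _ xmin] :=
  lsc_attains_min _ _ (S_compact i) Sn0 (@block_liminf_ge i).
by exists (f x).
Qed.

Lemma mulmx_coord_cvg {m k} (M : 'M[R]_(m, k)) j (x : 'cV[R]_k) :
  (M *m y) j 0 @[y --> x] --> (M *m x) j 0.
Proof.
rewrite [X in _ --> X]mxE; under eq_fun do rewrite mxE.
apply: (@cvg_sum R _ _ (nbhs x) (nbhs_filter x)) => l.
by apply: cvgMl_tmp; exact: coord_continuous.
Qed.

Hypothesis P_feasible : exists x, feasible S A b G h x.

Lemma relaxed_solution (t0 : R) :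
  (dual_value S (@f) A b G h <= t0%:E)%E ->
  exists L (theta : 'I_n * 'I_L -> R)
      (y : forall t : 'I_n * 'I_L, 'cV[R]_(d t.1)),
    [/\ (forall t, 0 <= theta t) /\ (forall i, \sum_k theta (i, k) = 1),
      forall t, S t.1 (y t),
      forall j, \sum_t theta t * (submxrow A t.1 *m y t) j 0 <= b j 0,
      forall j, \sum_t theta t * (submxrow G t.1 *m y t) j 0 = h j 0 &
      \sum_t theta t * f (y t) <= t0].
Proof.
move=> dual_t0; have [x0 [Ax0 Gx0 Sx0]] := P_feasible.
(* Each equation is split into two inequalities; the last index bounds the cost by [t0]. *)
pose I := ('I_m1 + ('I_m2 + 'I_m2) + unit)%type.
pose phi i (y : 'cV[R]_(d i)) (k : I) := match k with
  | inl (inl j) => (submxrow A i *m y) j 0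
  | inl (inr (inl j)) => (submxrow G i *m y) j 0
  | inl (inr (inr j)) => (submxrow (- G) i *m y) j 0
  | inr _ => f y end.
pose beta (k : I) := match k with
  | inl (inl j) => b j 0 | inl (inr (inl j)) => h j 0
  | inl (inr (inr j)) => - h j 0 | inr _ => t0 end.
have Sn0 i : S i !=set0 by exists (submxcol x0 i); exact: Sx0.
have phi_lsc i k x : S i x ->
    liminf_ge (within (S i) (nbhs x)) (fun x => phi i x k) (phi i x k).
  move=> Sx; have FF : ProperFilter (within (S i) (nbhs x)).
    by apply: within_nbhs_proper; exact: subset_closure.
  have lin m (M : 'M[R]_(m, \sum_i d i)) j : liminf_ge (within (S i) (nbhs x))
      (fun x => (submxrow M i *m x) j 0) ((submxrow M i *m x) j 0).
    by apply: liminf_ge_cvg; apply: cvg_within_filter; exact: mulmx_coord_cvg.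
  by case: k => [[j|[j|j]]|u] /=; [exact: lin..|exact: block_liminf_ge].
have [[lam [eta [lam0 eta0 sep]]]|[L [theta [y [th0 th1 yS th_le]]]]] :=
  mixture_alternative (fun i => 'cV[R]_(d i)) S phi beta S_compact Sn0 phi_lsc.
  pose l : 'cV[R]_m1 := \col_j lam (inl (inl j)).
  pose mu : 'cV[R]_m2 :=
    \col_j (lam (inl (inr (inl j))) - lam (inl (inr (inr j)))).
  pose tau := lam (inr tt).
  have {}sep x : in_domain S x -> eta <= tau * (objective (@f) x - t0) +
      \sum_j l j 0 * ((A *m x) j 0 - b j 0) +
      \sum_j mu j 0 * ((G *m x) j 0 - h j 0).
    move=> xS; have := sep (submxcol x) xS.
    rewrite !big_sumType /= (big_pred1 tt) => [|[]//].
    rewrite -/tau -/(objective (@f) x) => /le_trans; apply.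
    rewrite addrC -addrA lerD2l.
    apply: lerD; [|rewrite -big_split]; apply: ler_sum => j _ /=;
      rewrite le_eqVlt; apply/orP; left; apply/eqP;
      rewrite -!mulmx_blocks; first by rewrite [l j 0]mxE.
    have -> : (- G *m x) j 0 = - (G *m x) j 0 by rewrite mulNmx mxE.
    by rewrite [mu j 0]mxE; ring.
  (* With [tau = 0], the feasible point [x0] would make the right side of [sep] nonpositive, against
     [0 < eta]. *)
  have tau_gt0 : 0 < tau.
    rewrite lt_neqAle lam0 andbT eq_sym; apply/eqP => tau0.
    have := sep x0 Sx0; rewrite tau0 mul0r add0r Gx0.
    rewrite [X in _ + X]big1 ?addr0 => [|j _]; last by rewrite subrr mulr0.
    rewrite leNgt (le_lt_trans _ eta0) // sumr_le0 // => j _.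
    by rewrite mulr_ge0_le0 ?subr_le0 // mxE.
  (* Dividing the multipliers by [tau] gives a dual feasible pair of value at least
     [t0 + eta / tau], above the dual optimum. *)
  suff : (dual_value S (@f) A b G h >= (t0 + eta / tau)%:E)%E.
    move=> /le_trans/(_ dual_t0); rewrite lee_fin gerDl leNgt.
    by rewrite divr_gt0.
  apply: ereal_sup_ge.
  exists (dual_function S (@f) A b G h (tau^-1 *: l) (tau^-1 *: mu)).
    exists (tau^-1 *: l, tau^-1 *: mu) => //= j.
    by rewrite !mxE mulr_ge0 // invr_ge0 ltW.
  apply: le_ereal_inf_tmp => _ [x /= xS <-]; rewrite lee_fin lagrangianE.
  rewrite -lerBrDl -(ler_pM2l tau_gt0) mulrCA divff ?gt_eqF // mulr1.
  apply: le_trans (sep x xS) _.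
  have scale m (u : 'cV[R]_m) (v : 'I_m -> R) :
      tau * (\sum_j (tau^-1 *: u) j 0 * v j) = \sum_j u j 0 * v j.
    rewrite mulr_sumr; apply: eq_bigr => j _.
    by rewrite mxE !mulrA divff ?gt_eqF // mul1r.
  by rewrite !(mulrDr, mulrN) !scale; lra.
exists L, theta, y; split=> //.
- by move=> j; exact: (th_le (inl (inl j))).
- move=> j; apply/eqP; rewrite eq_le (th_le (inl (inr (inl j)))) /=.
  rewrite -lerN2 -sumrN; apply: le_trans (th_le (inl (inr (inr j)))).
  apply: ler_sum => t _ /=.
  rewrite (_ : submxrow (- G) t.1 = - submxrow G t.1).
    by rewrite mulNmx [X in _ <= _ * X]mxE mulrN.
  by apply/matrixP => ? ?; rewrite !mxE.
- exact: (th_le (inr tt)).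
Qed.

Lemma dual_value_le x : feasible S A b G h x ->
  (dual_value S (@f) A b G h <= (objective (@f) x)%:E)%E.
Proof.
move=> [Ax Gx Sx]; apply: ge_ereal_sup => _ [[l mu] /= l0 <-].
apply: le_trans (_ : ((lagrangian (@f) A b G h x l mu)%:E <= _)%E).
  by apply: ereal_inf_lbound; exists x.
rewrite lee_fin lagrangianE Gx [X in _ + X]big1 => [|j _]; last first.
  by rewrite subrr mulr0.
rewrite addr0 gerDl sumr_le0 // => j _.
by rewrite mulr_ge0_le0 ?subr_le0.
Qed.

Lemma dual_value_fin_num : dual_value S (@f) A b G h \is a fin_num.
Proof.
have [x0 Fx0] := P_feasible; have [_ _ Sx0] := Fx0.
rewrite fin_numE; apply/andP; split; last first.
  by rewrite -ltey (le_lt_trans (dual_value_le x0 Fx0)) ?ltry.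
have /choice[a fa] : forall i, exists a, forall x, S i x -> a <= f x.
  by move=> i; apply: block_lower_bound; exists (submxcol x0 i).
rewrite -ltNye (lt_le_trans (ltNyr (\sum_i a i))) //.
(* Zero multipliers leave only the objective, bounded below block by block. *)
apply: ereal_sup_ge; exists (dual_function S (@f) A b G h 0 0).
  by exists (0, 0) => //= j; rewrite mxE.
apply: le_ereal_inf_tmp => _ [x /= xS <-]; rewrite lee_fin lagrangianE.
rewrite [X in _ + X + _]big1 => [|j _]; last by rewrite mxE mul0r.
rewrite [X in _ + X]big1 => [|j _]; last by rewrite mxE mul0r.
by rewrite !addr0; apply: ler_sum => i _; exact: fa.
Qed.

Definition mixture {L} (theta : 'I_n * 'I_L -> R)
    (y : forall t : 'I_n * 'I_L, 'cV[R]_(d t.1)) : 'cV[R]_(\sum_i d i) :=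
  \mxcol_i (\sum_k theta (i, k) *: (y (i, k) : 'cV[R]_(d i))).

Lemma mulmx_mixture {m L} (M : 'M[R]_(m, \sum_i d i))
    (theta : 'I_n * 'I_L -> R) (y : forall t : 'I_n * 'I_L, 'cV[R]_(d t.1)) j :
  (M *m mixture theta y) j 0 = \sum_t theta t * (submxrow M t.1 *m y t) j 0.
Proof.
rewrite mulmx_blocks; transitivity (\sum_i \sum_k
    theta (i, k) * (submxrow M i *m y (i, k)) j 0).
  apply: eq_bigr => i _; rewrite mxcolK mulmx_sumr summxE.
  by apply: eq_bigr => k _; rewrite -scalemxAr mxE.
by rewrite pair_bigA /=; apply: eq_bigr => -[].
Qed.

Lemma relaxed_basic_solution (t0 : R) :
  (dual_value S (@f) A b G h <= t0%:E)%E ->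
  exists L (theta : 'I_n * 'I_L -> R)
      (y : forall t : 'I_n * 'I_L, 'cV[R]_(d t.1)),
    [/\ (forall t, 0 <= theta t) /\ (forall i, \sum_k theta (i, k) = 1),
      forall t, S t.1 (y t),
      (forall j, (A *m mixture theta y) j 0 <= b j 0) /\ G *m mixture theta y = h,
      \sum_t theta t * f (y t) <= t0 &
      (#|[set t | theta t != 0%R]%SET| <= n + (max_active A b + m2))%N].
Proof.
move=> /relaxed_solution[L [theta0 [y [[th0 th1] yS Ay Gy ft0]]]].
pose e (t : 'I_n * 'I_L) (p : 'I_n + 'I_m2) := match p with
  | inl i => (t.1 == i)%:R | inr j => (submxrow G t.1 *m y t) j 0 end.
have [|theta [th0' th_eq th_A th_f supp]] := basic_solution e
    (fun t j => (submxrow A t.1 *m y t) j 0) (fun j => b j 0) (fun t => f (y t))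
    theta0 _ th0 Ay.
  move=> delta de; transitivity (\sum_i \sum_k delta (i, k)).
    by rewrite pair_bigA /=; apply: eq_bigr => -[].
  by apply: big1 => i _; rewrite -sum_pair_fst; exact: (de (inl i)).
exists L, theta, y; split=> //.
- split=> // i.
  by have := th_eq (inl i); rewrite /e !sum_pair_fst th1.
- split=> [j|]; first by rewrite mulmx_mixture.
  apply/colP => j; rewrite mulmx_mixture -Gy.
  exact: (th_eq (inr j)).
- exact: le_trans th_f ft0.
- apply: leq_trans supp _; rewrite card_sum !card_ord -addnA leq_add2l addnC.
  rewrite leq_add2r.
  (* Inequalities tight for the weights are exactly those active at the averaged point, so
     [max_active] bounds their number. *)
  have -> : [set j | (\sum_t theta t * (submxrow A t.1 *m y t) j 0)%R == b j 0]%SET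
      = active_set A b (mixture theta y).
    by apply/setP => j; rewrite !inE !mxE subr_eq0 -mulmx_mixture mxE.
  by apply: leq_bigmax_cond; apply/asboolP; exists (mixture theta y).
Qed.

(** Outside the domain one summand is [+oo] and none is [-oo], so the bound is trivial there. This
    lets an averaged point be tested before its membership is known. *)
Lemma primal_value_le x : (forall j, (A *m x) j 0 <= b j 0) -> G *m x = h ->
  (primal_value S (@f) A b G h <=
   \sum_i extend_infty (S i) (EFin \o f) (submxcol x i))%E.
Proof.
move=> Ax Gx; have [xS|/existsNP[i xNS]] := pselect (in_domain S x).
  rewrite (eq_bigr (fun i => (f (submxcol x i))%:E)) => [|i _].
    by rewrite sumEFin; apply: ereal_inf_lbound; exists x.
  by rewrite /extend_infty patchT //; apply: mem_set; exact: xS.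
suff /eqP -> : (\sum_i extend_infty (S i) (EFin \o f) (submxcol x i) == +oo)%E.
  by rewrite leey.
rewrite esum_eqy => [|j _]; last by rewrite /extend_infty /patch; case: ifP.
apply/existsP; exists i; rewrite /extend_infty patchC //=.
exact/mem_set.
Qed.

End Relaxation.

(** * Counting mixed blocks and bounding the duality gap *)

(** Weights summing to 1 force a nonzero weight in every block, and a crowded block has at least one
    more. *)
Lemma card_crowded_blocks {R : realType} {n L : nat} (theta : 'I_n * 'I_L -> R) :
  (forall i, \sum_k theta (i, k) = 1) ->
  (n + #|[set i | 1 < #|[set k | theta (i, k) != 0%R]%SET|]%SET| <=
   #|[set t | theta t != 0%R]%SET|)%N.
Proof.
move=> th1.
have -> : #|[set t | theta t != 0%R]%SET| =
    (\sum_i #|[set k | theta (i, k) != 0%R]%SET|)%N.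
  under [RHS]eq_bigr do rewrite -sum1_card.
  rewrite pair_big_dep -sum1_card /=.
  by apply: eq_bigl => -[i k]; rewrite !inE.
have nE : n = (\sum_(i < n) 1)%N by rewrite sum1_card card_ord.
rewrite [X in (X + _)%N]nE -[X in (_ + X)%N]sum1_card.
rewrite [X in (_ + X)%N]big_mkcond -big_split /=; apply: leq_sum => i _.
rewrite inE; case: ltnP => //= _; rewrite addn0 card_gt0.
apply: contraPneq (th1 i) => supp0; rewrite big1.
  by apply/eqP; rewrite eq_sym oner_eq0.
by move=> k _; apply/eqP; move/setP/(_ k): supp0; rewrite !inE => /negbFE.
Qed.

Theorem mainTheorem3 (R : realType) (n : nat) (d : 'I_n -> nat)
    (S : forall i : 'I_n, set 'cV[R]_(d i))
    (f : forall i : 'I_n, 'cV[R]_(d i) -> R)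
    (m1 m2 : nat)
    (A : 'M[R]_(m1, \sum_i d i)) (b : 'cV[R]_m1)
    (G : 'M[R]_(m2, \sum_i d i)) (h : 'cV[R]_m2)
    (S_compact : forall i, compact (S i))
    (f_lsc : forall i, lower_semicontinuous
       (fun x : subspace (S i) => (f i x)%:E))
    (A_blocks : at_least_two_blocks A)
    (G_blocks : at_least_two_blocks G)
    (rho_sorted : forall i j : 'I_n, (i <= j)%N ->
       (nonconvexity (S j) (f j) <= nonconvexity (S i) (f i))%E)
    (P_feasible : exists x, feasible S A b G h x) :
  (esub (primal_value S f A b G h) (dual_value S f A b G h)
   <= \sum_(i < n | (i < minn (max_active A b + m2) n)%N)
        nonconvexity (S i) (f i))%E.
Proof.
have Sn0 i : S i !=set0.
  by have [x0 [_ _ Sx0]] := P_feasible; exists (submxcol x0 i).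
have rho0 i : (0 <= nonconvexity (S i) (f i))%E by exact: nonconvexity_ge0.
have dual_fin := dual_value_fin_num d S f A b G h S_compact f_lsc P_feasible.
pose t0 := fine (dual_value S f A b G h).
have dualE : dual_value S f A b G h = t0%:E by rewrite fineK.
have [|L [theta [y [[th0 th1] yS [Ax Gx] ft0 supp]]]] :=
  relaxed_basic_solution d S f A b G h S_compact f_lsc P_feasible t0.
  by rewrite dualE.
set x := mixture d theta y in Ax Gx.
pose B := [set i | (1 < #|[set k | theta (i, k) != 0%R]%SET|)%N]%SET.
have Bcard : (#|B| <= minn (max_active A b + m2) n)%N.
  rewrite leq_min; apply/andP; split; last by rewrite -[leqRHS]card_ord max_card.
  by rewrite -(leq_add2l n) (leq_trans _ supp) // card_crowded_blocks.
pose v i := \sum_k theta (i, k) * f i (y (i, k)).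
have block i : (extend_infty (S i) (EFin \o f i) (submxcol x i) <=
    (v i)%:E + if i \in B then nonconvexity (S i) (f i) else 0)%E.
  have -> : submxcol x i = \sum_k theta (i, k) *: (y (i, k) : 'cV[R]_(d i)).
    by rewrite /x /mixture mxcolK.
  case: ifP => [_|].
    apply: extend_infty_le_nonconvexity => //.
      exact: (block_lower_bound d S f S_compact f_lsc).
    by apply: convex_envelope_sum => // k; exact: (yS (i, k)).
  (* Outside [B] a single slot carries weight 1, so the average is a point of [S i] and its cost is
     exactly [v i]. *)
  rewrite inE => /negbT; rewrite -leqNgt => supp1.
  have [k0 thk0] : exists k, theta (i, k) != 0.
    apply: contrapT => /forallNP th_i0; have /eqP := th1 i.
    rewrite big1 => [|k _]; first by rewrite eq_sym oner_eq0.
    by apply/eqP/negP/negP; move: (th_i0 k) => /negP; rewrite negbK.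
  have th_eq0 k : k != k0 -> theta (i, k) = 0.
    move=> kk0; apply/eqP; apply: contraTT supp1 => thk.
    rewrite -ltnNge (cardD1 k0) inE thk0 (cardD1 k) !inE kk0 thk.
    by rewrite add1n ltnS leq_addr.
  have thk1 : theta (i, k0) = 1.
    by rewrite -(th1 i) (bigD1 k0) //= big1 ?addr0 // => k /th_eq0.
  have pick (V : lmodType R) (F : 'I_L -> V) : \sum_k theta (i, k) *: F k = F k0.
    rewrite (bigD1 k0) //= big1 ?addr0 => [|k /th_eq0 ->]; last by rewrite scale0r.
    by rewrite thk1 scale1r.
  rewrite pick adde0 /v (pick R^o (fun k => f i (y (i, k)))).
  by rewrite /extend_infty patchT //; apply: mem_set; exact: (yS (i, k0)).
have primal_le : (primal_value S f A b G h <=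
    t0%:E + \sum_(i in B) nonconvexity (S i) (f i))%E.
  apply: le_trans (primal_value_le d S f A b G h x Ax Gx) _.
  apply: (@le_trans _ _ (\sum_i ((v i)%:E +
    if i \in B then nonconvexity (S i) (f i) else 0))%E).
    by apply: lee_sum => i _; exact: block.
  rewrite big_split /= -big_mkcond sumEFin; apply: leeD2r; rewrite lee_fin.
  apply: le_trans ft0; rewrite /v pair_bigA /=.
  by rewrite le_eqVlt; apply/orP; left; apply/eqP; apply: eq_bigr => -[].
(* If both values coincide the gap is 0, and the bound is a sum of nonnegative terms. *)
rewrite /esub; case: ifP => _; first by rewrite sume_ge0.
rewrite leeBlDr // dualE addeC; apply: le_trans primal_le _.
by apply: leeD2l; exact: sum_sorted_le.
Qed.
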